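(* For $q\in(0,1/2]$, define $$g_q(y):=\log^2(2)+\big(\log(1-q)+y\big)\big(-\log(q)-y\big)$$ and $\hat f_q:[0,-\log(q)]\to\mathbb{R}_+$ by $$\hat f_q(y)=\frac{2\log^2(2)+\big(\log(1-q)+y\big)\log\frac{1-q}{q}+(\log 4)\sqrt{g_q(y)}}{\log^2\big((1-q)/q\big)+\log^2(2)}.$$ Then $\hat f_q(y)$ is concave and non-decreasing in $y$. Moreover, let $P$ and $Q$ be any two probability distributions on an alphabet $\mathcal{Z}$ and let $E\subseteq\mathcal{Z}$ be any event with $Q(E)\in(0,1/2]$ and $D(P\|Q)\le\log\frac{1}{Q(E)}$. Then $$P(E)\le\hat f_{Q(E)}\big(D(P\|Q)\big).$$ In particular, for any joint distribution $P_{XY}$ on $\mathcal{X}\times\mathcal{Y}$ with marginals $P_X$, $P_Y$ and any event $E\subseteq\mathcal{X}\times\mathcal{Y}$ with $P_XP_Y(E)\in(0,1/2]$ and $I(X;Y)\le\log\frac{1}{P_XP_Y(E)}$, $$P_{XY}(E)\le\hat f_{P_XP_Y(E)}\big(I(X;Y)\big).$$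
   Context: Logarithms are natural, and $\log^2(x)=(\log x)^2$. $D(P\|Q)$ is the Kullback–Leibler divergence. $P_XP_Y$ denotes the product of the marginals of $P_{XY}$, and $I(X;Y)=D(P_{XY}\|P_XP_Y)$ is the mutual information. *)

(* Defs.v *)
From HB Require Import structures.
From mathcomp Require Import all_boot all_order all_algebra.
From mathcomp Require Import all_classical all_reals all_analysis.

Set Implicit Arguments.
Unset Strict Implicit.
Unset Printing Implicit Defensive.

Import Order.TTheory GRing.Theory Num.Theory.
Import numFieldNormedType.Exports.

Local Open Scope classical_set_scope.
Local Open Scope ring_scope.
Local Open Scope convex_scope.

HB.instance Definition _ d1 d2 (X : measurableType d1) (Y : measurableType d2) :=
  isMeasurableFun.Build _ _ _ _ (@fst X Y) measurable_fst.

HB.instance Definition _ d1 d2 (X : measurableType d1) (Y : measurableType d2) :=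
  isMeasurableFun.Build _ _ _ _ (@snd X Y) measurable_snd.

(* Since lne is -oo on nonpositive arguments, log 0 = -oo; under P `<< Q the
   density is positive P-almost everywhere, so this value is immaterial.  The
   negative part of the integrand always has a finite P-integral, so that the
   extended-real integral is never of the undetermined form +oo - oo. *)
Definition KL_divergence (d : measure_display) (T : measurableType d)
    (R : realType) (P Q : probability T R) : \bar R :=
  if pselect (P `<< Q) is left _ then
    (\int[P]_x lne (Radon_Nikodym (charge_of_finite_measure P) Q x))%E
  else +oo%E.

Definition marginal1 (d1 d2 : measure_display) (X : measurableType d1)
    (Y : measurableType d2) (R : realType) (PXY : probability (X * Y)%type R) :
    probability X R :=
  distribution PXY fst.

Definition marginal2 (d1 d2 : measure_display) (X : measurableType d1)
    (Y : measurableType d2) (R : realType) (PXY : probability (X * Y)%type R) :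
    probability Y R :=
  distribution PXY snd.

Definition marginal_product (d1 d2 : measure_display) (X : measurableType d1)
    (Y : measurableType d2) (R : realType) (PXY : probability (X * Y)%type R) :
    probability (X * Y)%type R :=
  (marginal1 PXY \x marginal2 PXY)%E.

Definition mutual_information (d1 d2 : measure_display) (X : measurableType d1)
    (Y : measurableType d2) (R : realType) (PXY : probability (X * Y)%type R) :
    \bar R :=
  KL_divergence PXY (marginal_product PXY).

(* The counterpart of convex_function with the inequality reversed. *)
Definition concave_function (R : numFieldType) (E : lmodType R)
    (E' := convex_lmodType E) (D : set E') (f : E' -> R^o) :=
  forall t : {i01 R},
    {in D &, forall x y : E', (f x <| t |> f y <= f (x <| t |> y))%R}.

Definition g_ (R : realType) (q y : R) : R :=
  ln 2 ^+ 2 + (ln (1 - q) + y) * (- ln q - y).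

(* Total in y; only its values for y in [0, - ln q] are meaningful. *)
Definition fhat (R : realType) (q y : R) : R :=
  (2 * ln 2 ^+ 2 + (ln (1 - q) + y) * ln ((1 - q) / q)
     + ln 4 * Num.sqrt (g_ q y))
  / (ln ((1 - q) / q) ^+ 2 + ln 2 ^+ 2).

(* Main.v *)
(* Coarsening to {E, E^c} gives d(p || q) <= D(P || Q) =: y for the binary
   divergence, with p = P(E) and q = Q(E).  Since
   d(p || q) = p ln ((1 - q) / q) - ln (1 - q) - h(p), the entropy bound
   h(p) <= 2 ln 2 sqrt (p (1 - p)) turns this into a quadratic inequality in p,
   whose larger root is at most fhat q y.  The entropy bound says that
   h(p) / sqrt (p (1 - p)) is maximal at p = 1 / 2; the sign of its derivative
   comes down to Jensen's inequality for ln at 1 + u and u with weights 1 - u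
   and u, whose barycentre is 1.  By AM-GM it also gives
   ln q ln (1 - q) <= ln^2 2, that is, g_q(0) >= 0.  As g_q is a concave
   quadratic, fhat q is concave, and it is non-decreasing because it attains
   its maximum at the right end point. *)

Require Import Defs.
From HB Require Import structures.
From mathcomp Require Import all_boot all_order all_algebra ring lra.
From mathcomp Require Import all_classical all_reals all_analysis.
From mathcomp Require Import measurable_realfun.

Import Order.TTheory GRing.Theory Num.Theory.
Import numFieldNormedType.Exports.

Local Open Scope classical_set_scope.
Local Open Scope ring_scope.

(** * Logarithm inequalities and the bound on the binary entropy *)

Lemma ln_le_subr1 {R : realType} (x : R) : 0 < x -> ln x <= x - 1.
Proof.
by move=> x0; have := @le_ln1Dx R (x - 1); rewrite addrCA subrr addr0; apply; lra.
Qed.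

Lemma ln2_gt0 {R : realType} : 0 < ln 2 :> R.
Proof. by apply: ln_gt0; lra. Qed.

Lemma ln_jensen1 {R : realType} (u : R) : 0 < u <= 1 ->
  (1 - u) * ln (1 + u) + u * ln u <= 0.
Proof.
move=> /andP[u0 u1]; have u1' : 0 < 1 + u by lra.
(* tangent-line bounds at the barycentre 1 of 1 + u and u *)
have h1 := ln_le_subr1 _ u1'; have h2 := ln_le_subr1 _ u0.
have : (1 - u) * ln (1 + u) <= (1 - u) * u by apply: ler_wpM2l; lra.
have : u * ln u <= u * (u - 1) by rewrite ler_pM2l.
lra.
Qed.

(* With x = sqrt (p / (1 - p)) this is h(p) / sqrt (p (1 - p)), where h is the
   binary entropy; it takes the value 2 ln 2 at p = 1 / 2. *)
Definition entropy_ratio {R : realType} (x : R) : R :=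
  (x + x^-1) * ln (1 + x ^+ 2) - 2 * (x * ln x).

Lemma is_derive_entropy_ratio {R : realType} (x : R) : 0 < x ->
  is_derive x 1 entropy_ratio ((1 - (x ^+ 2)^-1) * ln (1 + x ^+ 2) - 2 * ln x).
Proof.
move=> x0; have x20 : 0 < 1 + x ^+ 2 by rewrite ltr_pwDl// sqr_ge0.
have d1 : is_derive x (1:R) (fun y : R => 1 + y ^+ 2) (2 * x).
  apply: is_derive_eq; rewrite /GRing.scale/= ; ring.
have d2 : is_derive x (1:R) (fun y : R => ln (1 + y ^+ 2)) ((1 + x ^+ 2)^-1 * (2 * x)).
  exact: (@is_derive1_comp R (@ln R) (fun y => 1 + y ^+ 2) x _ _
    (is_derive1_ln x20) d1).
have d3 : is_derive x (1:R) (fun y : R => y^-1) (- (x ^- 2)).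
  have xn0 : x != 0 by rewrite gt_eqF.
  by have := is_deriveV xn0 (is_derive_id x (1 : R)); rewrite /GRing.scale/= mulr1.
have d4 := is_derive1_ln x0.
rewrite /entropy_ratio; apply: is_derive_eq.
rewrite /GRing.scale/=.
by field; rewrite !gt_eqF.
Qed.

(** The derivative is [- x^-2] times the left side of [ln_jensen1] at [u = x^2]. *)
Lemma entropy_ratio_homo {R : realType} :
  {in `]0, 1]%R &, {homo (@entropy_ratio R) : x y / x <= y}}.
Proof.
apply: ger0_derive1_le_oc.
- move=> x /[!in_itv]/= /andP[x0 _].
  exact: (@ex_derive _ _ _ _ _ _ _ (is_derive_entropy_ratio _ x0)).
- move=> x /[!in_itv]/= /andP[x0 x1].
  rewrite derive1E (@derive_val _ _ _ _ _ _ _ (is_derive_entropy_ratio _ x0)).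
  have x20 : 0 < x ^+ 2 by rewrite exprn_gt0.
  have x21 : x ^+ 2 <= 1 by rewrite expr_le1// ltW.
  have := @ln_jensen1 R (x ^+ 2); rewrite x20 x21 => /(_ isT).
  rewrite lnXn// -(@ler_pM2l _ (x ^+ 2)^-1) ?invr_gt0// mulr0 => h.
  suff -> : (1 - (x ^+ 2)^-1) * ln (1 + x ^+ 2) - 2 * ln x =
   - ((x ^+ 2)^-1 * ((1 - x ^+ 2) * ln (1 + x ^+ 2) + x ^+ 2 * (ln x *+ 2))).
    by rewrite oppr_ge0.
  by rewrite mulr2n; field; rewrite gt_eqF.
- apply: derivable_within_continuous => x /[!in_itv]/= /andP[x0 _].
  exact: (@ex_derive _ _ _ _ _ _ _ (is_derive_entropy_ratio _ x0)).
Qed.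

Lemma entropy_le_sqrt {R : realType} (p : R) : 0 <= p <= 1 ->
  - (p * ln p + (1 - p) * ln (1 - p)) <= 2 * ln 2 * Num.sqrt (p * (1 - p)).
Proof.
(* Both sides are symmetric under [p -> 1 - p], and this half gives [s / c <= 1], the range where
   [entropy_ratio] is known to be monotone. *)
wlog ph : p / p <= 1 / 2.
  move=> wl p01; have [|p2] := leP p (1 / 2); first by move/wl; apply.
  have := wl (1 - p); rewrite opprB addrCA subrr addr0.
  by rewrite [(1 - p) * ln _ + _]addrC [(1 - p) * p]mulrC; apply; lra.
move=> /andP[p0 _]; move: p0; rewrite le_eqVlt => /predU1P[<-|p0].
  by rewrite subr0 !mul0r ln1 mulr0 addr0 sqrtr0 mulr0 oppr0.
have q0 : 0 < 1 - p by lra.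
have [s0 c0] : 0 < Num.sqrt p /\ 0 < Num.sqrt (1 - p) by rewrite !sqrtr_gt0.
set s := Num.sqrt p in s0 *; set c := Num.sqrt (1 - p) in c0 *.
have sE : s ^+ 2 = p by rewrite sqr_sqrtr// ltW.
have cE : c ^+ 2 = 1 - p by rewrite sqr_sqrtr// ltW.
rewrite sqrtrM -/s -/c; last exact: ltW.
have sc1 : 0 < s / c <= 1.
  rewrite divr_gt0//= ler_pdivrMr// mul1r -(@ler_pXn2r _ 2)// ?nnegrE ?sqrtr_ge0//.
  by rewrite sE cE; lra.
have := @entropy_ratio_homo R (s / c) 1; rewrite !in_itv/= sc1 ltr01 lexx => /(_ isT isT).
case/andP: (sc1) => _ -> /(_ isT).
rewrite /entropy_ratio invr1 expr1n ln1 !mulr0 subr0.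
have -> : 1 + (s / c) ^+ 2 = (c ^+ 2)^-1.
  rewrite expr_div_n sE cE; field; lra.
(* Multiplying by [s * c] turns the ratio back into the entropy, as [s^2 + c^2 = 1]. *)
rewrite lnV ?posrE ?exprn_gt0// ln_div ?posrE// -(@ler_pM2r _ (s * c)) ?mulr_gt0//.
move=> h.
have lp : ln p = 2 * ln s by rewrite -sE lnXn// mulr2n mulrDl mul1r.
have lq : ln (1 - p) = 2 * ln c by rewrite -cE lnXn// mulr2n mulrDl mul1r.
rewrite cE lq in h.
have e2 : 1 + 1 = 2 :> R by lra.
rewrite e2 in h; apply: le_trans h.
rewrite lp lq.
suff -> : ((s / c + (s / c)^-1) * - (2 * ln c) - 2 * (s / c * (ln s - ln c))) * (s * c)
  = - ((s^+2 + c^+2) * 2 * ln c + s ^+2 * 2 * ln s - s ^+ 2 * 2 * ln c).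
  rewrite sE cE; lra.
by field; rewrite !gt_eqF.
Qed.

(** With [a = - ln q] and [b = - ln (1 - q)], AM-GM gives [4 q (1 - q) a b <= (q a + (1 - q) b)^2];
    the right side is the squared entropy, at most [4 q (1 - q) ln^2 2]. *)
Lemma lnM_ln1B_le {R : realType} (q : R) : 0 < q < 1 ->
  ln q * ln (1 - q) <= ln 2 ^+ 2.
Proof.
move=> /andP[q0 q1]; have q'0 : 0 < 1 - q by lra.
have q01 : 0 <= q <= 1 by lra.
have := entropy_le_sqrt _ q01.
set a := - ln q; set b := - ln (1 - q).
have a0 : 0 < a by rewrite oppr_gt0 ln_lt0 ?q0.
have b0 : 0 < b by rewrite oppr_gt0 ln_lt0 ?q'0//; lra.
have [s0 l0] : 0 < Num.sqrt (q * (1 - q)) /\ 0 < ln 2 :> R.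
  by rewrite sqrtr_gt0 mulr_gt0// ln2_gt0.
have -> : ln q * ln (1 - q) = a * b by rewrite /a /b mulrNN.
have -> : - (q * ln q + (1 - q) * ln (1 - q)) = q * a + (1 - q) * b.
  by rewrite /a /b; ring.
move=> h.
have h2 : (q * a + (1 - q) * b) ^+ 2 <= 4 * ln 2 ^+ 2 * (q * (1 - q)).
  have -> : 4 * ln 2 ^+ 2 * (q * (1 - q)) = (2 * ln 2 * Num.sqrt (q * (1 - q))) ^+ 2.
    by rewrite !exprMn sqr_sqrtr ?mulr_ge0// ?ltW//; ring.
  have u0 : 0 <= q * a + (1 - q) * b by rewrite addr_ge0 ?mulr_ge0// ltW.
  by rewrite ler_pXn2r ?nnegrE ?(le_trans u0 h).
rewrite -(@ler_pM2r _ (4 * (q * (1 - q)))) ?mulr_gt0//.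
have := sqr_ge0 (q * a - (1 - q) * b).
nra.
Qed.

(** * Concavity and monotonicity of [fhat], and the quadratic inequality *)

Lemma sqrt_affine_le {R : realType} (t a b : R) :
  0 <= t <= 1 -> 0 <= a -> 0 <= b ->
  t * Num.sqrt a + (1 - t) * Num.sqrt b <= Num.sqrt (t * a + (1 - t) * b).
Proof.
move=> /andP[t0 t1] a0 b0.
have h0 : 0 <= t * Num.sqrt a + (1 - t) * Num.sqrt b.
  by rewrite addr_ge0 ?mulr_ge0 ?sqrtr_ge0//; lra.
have h1 : 0 <= t * a + (1 - t) * b.
  by rewrite addr_ge0 ?mulr_ge0//; lra.
rewrite -[X in X <= _]ger0_norm// -sqrtr_sqr ler_sqrt//.
have := sqr_sqrtr a0; have := sqr_sqrtr b0.
move: (Num.sqrt a) (Num.sqrt b) => u v {h0 h1 a0 b0} <- <-.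
(* This is exactly the gap between the two squared sides. *)
have : 0 <= t * (1 - t) * (u - v) ^+ 2 by rewrite mulr_ge0 ?sqr_ge0 ?mulr_ge0//; lra.
nra.
Qed.

Section fhat_shape.
Context {R : realType}.
Implicit Types q p x y t : R.

Local Notation l := (ln 2 : R).
Local Notation L q := (ln ((1 - q) / q)).

Lemma ln_oddsE q : 0 < q <= 1 / 2 -> L q = ln (1 - q) - ln q.
Proof. by move=> q01; rewrite ln_div// posrE; lra. Qed.

Lemma ln_odds_ge0 q : 0 < q <= 1 / 2 -> 0 <= L q.
Proof. by move=> q01; rewrite ln_ge0// ler_pdivlMr; lra. Qed.

Lemma fhat_den_gt0 q : 0 < L q ^+ 2 + l ^+ 2.
Proof. by rewrite ltr_wpDl ?sqr_ge0// exprn_gt0// ln2_gt0. Qed.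

Lemma g_factorE q y : 0 < q <= 1 / 2 ->
  g_ q y = l ^+ 2 + (ln (1 - q) + y) * (L q - (ln (1 - q) + y)).
Proof. by move=> q01; rewrite /g_ ln_oddsE//; ring. Qed.

Lemma fhatE q y : fhat q y =
  (2 * l ^+ 2 + (ln (1 - q) + y) * L q + 2 * l * Num.sqrt (g_ q y))
  / (L q ^+ 2 + l ^+ 2).
Proof.
rewrite /fhat; have -> : 4 = 2 ^+ 2 :> R by lra.
by rewrite lnXn// mulr2n [2 * l]mulrDl mul1r.
Qed.

(** [g_ q y] is the sum of [ln^2 2 - ln q ln (1 - q)], [y (- ln q - y)] and [- y ln (1 - q)], each
    nonnegative. *)
Lemma g_ge0 q y : 0 < q <= 1 / 2 -> 0 <= y <= - ln q -> 0 <= g_ q y.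
Proof.
move=> q01 /andP[y0 y1]; have q1 : 0 < q < 1 by lra.
have := lnM_ln1B_le _ q1; rewrite /g_ => h.
have lq : ln (1 - q) <= 0 by rewrite ln_le0//; lra.
have : 0 <= y * (- ln q - y) by rewrite mulr_ge0//; lra.
have : 0 <= y * - ln (1 - q) by rewrite mulr_ge0//; lra.
nra.
Qed.

Lemma fhat_num_ge0 q y : 0 < q <= 1 / 2 -> 0 <= y <= - ln q ->
  0 <= 2 * l ^+ 2 + (ln (1 - q) + y) * L q + 2 * l * Num.sqrt (g_ q y).
Proof.
move=> q01 /andP[y0 y1]; have l0 := @ln2_gt0 R.
rewrite addr_ge0//; last by rewrite !mulr_ge0 ?sqrtr_ge0// ltW.
have q1 : 0 < q < 1 by lra.
(* Without [y L] and the root there remains [2 l^2 + ln^2 (1 - q) - ln q ln (1 - q)], whose last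
   product is at most [l^2]. *)
have h := lnM_ln1B_le _ q1.
have : 0 <= y * L q by rewrite mulr_ge0// ln_odds_ge0.
have := sqr_ge0 (ln (1 - q)); have := sqr_ge0 l.
rewrite ln_oddsE//; nra.
Qed.

Lemma fhat_ge0 q y : 0 < q <= 1 / 2 -> 0 <= y <= - ln q -> 0 <= fhat q y.
Proof.
by move=> q01 y01; rewrite fhatE divr_ge0 ?fhat_num_ge0// ltW ?fhat_den_gt0.
Qed.

Lemma fhat_affine_ge q t x y : 0 < q <= 1 / 2 -> 0 <= t <= 1 ->
    0 <= x <= - ln q -> 0 <= y <= - ln q ->
  t * fhat q x + (1 - t) * fhat q y <= fhat q (t * x + (1 - t) * y).
Proof.
move=> q01 t01 x01 y01; have l0 := @ln2_gt0 R.
rewrite !fhatE [t * _]mulrA [(1 - t) * _]mulrA -mulrDl ler_pM2r ?invr_gt0 ?fhat_den_gt0//.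
have h := sqrt_affine_le _ _ _ t01 (g_ge0 _ _ q01 x01) (g_ge0 _ _ q01 y01).
have gxy : t * g_ q x + (1 - t) * g_ q y <= g_ q (t * x + (1 - t) * y).
  have : 0 <= t * (1 - t) * (x - y) ^+ 2.
    by rewrite mulr_ge0 ?sqr_ge0 ?mulr_ge0//; lra.
  rewrite /g_; nra.
have h2 : Num.sqrt (t * g_ q x + (1 - t) * g_ q y) <=
    Num.sqrt (g_ q (t * x + (1 - t) * y)) by rewrite ler_wsqrtr.
have : 0 <= 2 * l * (Num.sqrt (g_ q (t * x + (1 - t) * y)) -
    (t * Num.sqrt (g_ q x) + (1 - t) * Num.sqrt (g_ q y))).
  by rewrite !mulr_ge0 ?subr_ge0 ?(le_trans h)// ltW.
lra.
Qed.

(** With [c = ln (1 - q) + y] and [s = sqrt (g_ q y)] one has [s^2 = l^2 + c (L - c)]; adding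
    [(s - l)^2 >= 0] and [(c - L)^2 >= 0] compares the numerators. *)
Lemma fhat_le_max q y : 0 < q <= 1 / 2 -> 0 <= y <= - ln q ->
  fhat q y <= fhat q (- ln q).
Proof.
move=> q01 y01; rewrite !fhatE ler_pM2r ?invr_gt0 ?fhat_den_gt0//.
have -> : g_ q (- ln q) = l ^+ 2 by rewrite /g_ subrr mulr0 addr0.
rewrite sqrtr_sqr gtr0_norm ?ln2_gt0//.
have := sqr_sqrtr (g_ge0 _ _ q01 y01); rewrite g_factorE//.
move: (Num.sqrt _) => s.
rewrite -ln_oddsE//.
move: (ln (1 - q) + y) => c sE.
have := sqr_ge0 (s - ln 2); have := sqr_ge0 (c - L q); nra.
Qed.

Lemma fhat_homo q : 0 < q <= 1 / 2 ->
  {in `[0, - ln q] &, {homo fhat q : x y / x <= y}}.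
Proof.
move=> q01 x y /[!in_itv]/= x01 y01 xy.
set z := - ln q.
have [->//|xz] := eqVneq y x.
have xz' : 0 < z - x by rewrite /z; have : x < y by [rewrite lt_neqAle eq_sym xz]; lra.
(* The weight with [y = t x + (1 - t) z]: by concavity [fhat q y] is at least a mean of [fhat q x]
   and the maximum [fhat q z]. *)
pose t := (z - y) / (z - x).
have t01 : 0 <= t <= 1.
  rewrite /t divr_ge0 ?(ltW xz')//=; last by rewrite /z; lra.
  by rewrite ler_pdivrMr// mul1r; lra.
have z0 : 0 <= z <= z by rewrite lexx andbT /z; lra.
have -> : y = t * x + (1 - t) * z by rewrite /t; field; rewrite gt_eqF.
apply: le_trans (fhat_affine_ge _ _ _ _ q01 t01 x01 z0).
have := fhat_le_max _ _ q01 x01; rewrite -/z => h.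
have : 0 <= (1 - t) * (fhat q z - fhat q x) by rewrite mulr_ge0//; lra.
lra.
Qed.

(* [p] lies below the larger root of
   (L^2 + 4 ln^2 2) p^2 - 2 (L c + 2 ln^2 2) p + c^2, with c = ln (1 - q) + y,
   and replacing the coefficient 4 ln^2 2 by ln^2 2 in the denominator only
   increases the bound. *)
Lemma le_fhat q p y : 0 < q <= 1 / 2 -> 0 <= p <= 1 -> 0 <= y <= - ln q ->
  p * L q - (ln (1 - q) + y) <= 2 * l * Num.sqrt (p * (1 - p)) ->
  p <= fhat q y.
Proof.
move=> q01 + y01; have l0 := @ln2_gt0 R; have L0 := ln_odds_ge0 _ q01.
have := fhat_num_ge0 _ _ q01 y01; rewrite fhatE.
have := g_ge0 _ _ q01 y01; rewrite g_factorE//.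
have : ln (1 - q) + y <= L q by rewrite ln_oddsE//; lra.
move: (fhat_den_gt0 q) L0 (ln (1 - q) + y).
move: (L q) => L den_gt0 L_ge0 c cL g0 N0.
set N := 2 * _ ^+ 2 + _ + _ in N0 *.
(* Squaring requires [p' L - c >= 0]. When [p L < c], the larger point [c / L], where this
   difference vanishes, takes the place of [p]. *)
suff main p' : 0 <= p' <= 1 -> 0 <= p' * L - c ->
    p' * L - c <= 2 * l * Num.sqrt (p' * (1 - p')) -> p' <= N / (L ^+ 2 + l ^+ 2).
  move=> p01 h; have [h0|h0] := leP 0 (p * L - c); first exact: main.
  have L0 : 0 < L.
    rewrite lt_neqAle L_ge0 andbT; apply/eqP => L0; move: h0 cL.
    by rewrite -L0 mulr0; lra.
  have pc : p <= c / L by rewrite ler_pdivlMr//; lra.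
  have cp : c / L * L - c = 0 by rewrite divfK ?subrr// gt_eqF.
  apply: (le_trans pc); apply: main; rewrite ?cp//.
    have -> : c / L <= 1 by rewrite ler_pdivrMr// mul1r.
    by rewrite andbT (le_trans _ pc)//; lra.
  by rewrite !mulr_ge0 ?sqrtr_ge0// ltW.
move=> /andP[p0 p1] h0 h.
set A := L ^+ 2 + 4 * l ^+ 2.
have A0 : 0 < A by rewrite ltr_wpDl ?sqr_ge0// mulr_gt0// exprn_gt0.
apply: (@le_trans _ _ (N / A)); last first.
  rewrite ler_wpM2l// lef_pV2 ?posrE// /A lerD2l.
  have := sqr_ge0 l; lra.
rewrite ler_pdivlMr//.
set B := L * c + 2 * l ^+ 2.
have : (p' * L - c) ^+ 2 <= 4 * l ^+ 2 * (p' * (1 - p')).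
  have pp : 0 <= p' * (1 - p') by rewrite mulr_ge0//; lra.
  have -> : 4 * l ^+ 2 * (p' * (1 - p')) = (2 * l * Num.sqrt (p' * (1 - p'))) ^+ 2.
    by rewrite !exprMn sqr_sqrtr//; ring.
  by rewrite ler_pXn2r ?nnegrE// (le_trans h0 h).
move=> quad.
(* Completing the square after multiplying by [A], with [B^2 - A c^2 = 4 l^2 (l^2 + c (L - c))]. *)
have sq : (p' * A - B) ^+ 2 <= (2 * l * Num.sqrt (l ^+ 2 + c * (L - c))) ^+ 2.
  rewrite !exprMn sqr_sqrtr//.
  have : 0 <= A * (4 * l ^+ 2 * (p' * (1 - p')) - (p' * L - c) ^+ 2).
    by rewrite mulr_ge0 ?(ltW A0)// subr_ge0.
  rewrite /A /B; nra.
have : p' * A - B <= 2 * l * Num.sqrt (l ^+ 2 + c * (L - c)).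
  apply: le_trans (ler_norm _) _; rewrite -ler_sqr ?nnegrE ?normr_ge0//.
    by rewrite real_normK ?num_real.
  by rewrite !mulr_ge0 ?sqrtr_ge0// ltW.
rewrite /N /B; lra.
Qed.

End fhat_shape.

Lemma concave_fhat {R : realType} (q : R) : 0 < q <= 1 / 2 ->
  concave_function ([set` `[0, - ln q]] : set R) (fhat q).
Proof.
move=> q01 t x y /[!inE]/= /[!in_itv]/= x01 y01.
have t01 : 0 <= (t%:num : R) <= 1 by rewrite ge0 le1.
exact: (fhat_affine_ge _ _ _ _ q01 t01 x01 y01).
Qed.

(** * A positive version of the density *)

Section density.
Context {d : measure_display} {T : measurableType d} {R : realType}.
Variables P Q : probability T R.
Hypothesis PQ : P `<< Q.
Local Open Scope ereal_scope.
Local Open Scope charge_scope.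

Local Notation phi := (Radon_Nikodym_SigmaFinite.f P Q).

Let phi_meas : measurable_fun [set: T] (phi : T -> \bar R).
Proof.
exact: measurable_int (Radon_Nikodym_SigmaFinite.f_integrable PQ).
Qed.

(* A version of dP/dQ up to P-null sets that is everywhere positive, so that
   the tangent-line bounds for its logarithm hold pointwise. *)
Definition pos_density x : R := (if 0 < fine (phi x) then fine (phi x) else 1)%R.

Lemma pos_density_gt0 x : (0 < pos_density x)%R.
Proof. by rewrite /pos_density; case: ifP. Qed.

Lemma measurable_pos_density : measurable_fun setT pos_density.
Proof.
have mf : measurable_fun setT (fun x => fine (phi x)) by exact: measurableT_comp.
by apply: measurable_fun_ifT => //; exact: measurable_fun_ltr.
Qed.

(** The two functions differ only where [phi] vanishes, and the [P]-measure of that set is the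
    [Q]-integral of [phi] over it, namely 0. *)
Lemma ae_eq_pos_density : ae_eq P setT phi (EFin \o pos_density).
Proof.
pose N := [set x | phi x = 0].
have mN : measurable N.
  by rewrite -[N]setTI; exact: (phi_meas measurableT _ (emeasurable_set1 0)).
exists N; split=> //.
  apply: etrans (Radon_Nikodym_SigmaFinite.f_integral PQ mN) _.
  by rewrite integral0_eq.
apply: subsetCl => x /= phi0 _.
have := Radon_Nikodym_SigmaFinite.f_ge0 PQ x.
have := Radon_Nikodym_SigmaFinite.f_fin_num PQ x.
rewrite /pos_density; move: phi0; rewrite /N/=; case: (phi x) => //= r r0 _.
rewrite lee_fin le_eqVlt => /predU1P[r0'|->//].
by case: r0; rewrite -r0'.
Qed.

Lemma KL_divergenceE : KL_divergence P Q = \int[P]_x (ln (pos_density x))%:E.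
Proof.
rewrite /KL_divergence; case: pselect => // PQ'.
have mRN : measurable_fun setT
    (fun x => fine ('d (charge_of_finite_measure P) '/d Q x)).
  exact: measurableT_comp.
apply: ae_eq_integral => //.
- rewrite (_ : (fun x => _) = fun x =>
      if (fine ('d (charge_of_finite_measure P) '/d Q x) <= 0)%R then -oo
      else (ln (fine ('d (charge_of_finite_measure P) '/d Q x)))%:E).
    apply: measurable_fun_ifT => //; first exact: measurable_fun_ler.
    by apply/measurable_EFinP; exact: measurableT_comp.
  apply/funext => x.
  by rewrite -[X in lne X]fineK// Radon_Nikodym_fin_num.
- apply/measurable_EFinP; apply: measurableT_comp => //.
  exact: measurable_pos_density.
(* The derivative is determined up to [Q]-null sets, which are [P]-null by domination. *)
have h1 : ae_eq P setT phi ('d (charge_of_finite_measure P) '/d Q).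
  by apply: null_dominates_ae_eq PQ _ => //; exact: ae_eq_Radon_Nikodym_SigmaFinite.
have := ae_eq_comp (@lne R) (ae_eq_trans (ae_eq_sym h1) ae_eq_pos_density).
apply: filterS => x /(_ I) h _; apply: etrans h _.
exact: lne_EFin (pos_density_gt0 x).
Qed.

Lemma measurable_inv_pos_density :
  measurable_fun setT (fun x => (pos_density x)^-1)%R.
Proof.
rewrite (_ : (fun x => _) = fun x => expR (- ln (pos_density x))).
  apply: measurableT_comp => //; apply: measurableT_comp => //.
  by apply: measurableT_comp => //; exact: measurable_pos_density.
by apply/funext => x; rewrite expRN lnK// posrE pos_density_gt0.
Qed.

(** As a [Q]-integral the integrand becomes 1 where [phi > 0] and 0 elsewhere; equality can fail
    because [Q] may charge the zero set of [phi]. *)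
Lemma integral_inv_pos_density A : measurable A ->
  \int[P]_(x in A) (pos_density x)^-1%:E <= Q A.
Proof.
move=> mA.
have mf : measurable_fun A (fun x => (pos_density x)^-1%:E).
  by apply/measurable_EFinP/measurable_funTS; exact: measurable_inv_pos_density.
have f0 x : 0 <= (pos_density x)^-1%:E.
  by rewrite lee_fin invr_ge0 ltW// pos_density_gt0.
rewrite -(Radon_Nikodym_SigmaFinite.change_of_variables PQ)//.
rewrite -[leRHS]mul1e -integral_cst//.
apply: ge0_le_integral => //.
- by move=> x _; rewrite mule_ge0// Radon_Nikodym_SigmaFinite.f_ge0.
- by apply: emeasurable_funM => //; exact: measurable_funTS.
move=> x _ /=; have := Radon_Nikodym_SigmaFinite.f_ge0 PQ x.
have := Radon_Nikodym_SigmaFinite.f_fin_num PQ x.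
rewrite /pos_density; case: (phi x) => //= r _.
rewrite lee_fin le_eqVlt => /predU1P[<-|r0]; first by rewrite ltxx mule0 lee_fin.
by rewrite r0 -EFinM mulVf// gt_eqF.
Qed.
End density.

(** * Integrability of the log-density and the log-sum inequality *)

Section divergence.
Context {d : measure_display} {T : measurableType d} {R : realType}.
Variables P Q : probability T R.
Hypothesis PQ : P `<< Q.

Local Notation f := (pos_density P Q).

(** Tangent-line bound for [ln (r / f x)]. It is affine in [1 / f], whose [P]-integral is controlled
    by [Q], and [r] is left free for tuning. *)
Lemma ln_pos_density_ge r x : 0 < r ->
  1 + ln r - r * (f x)^-1 <= ln (f x).
Proof.
move=> r0; have f0 := pos_density_gt0 P Q x.
have := ln_le_subr1 (r / f x) (divr_gt0 r0 f0).
rewrite ln_div ?posrE//; lra.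
Qed.

Lemma measurable_ln_pos_density : measurable_fun [set: T] (fun x => ln (f x)).
Proof. by apply: measurableT_comp => //; exact: measurable_pos_density. Qed.

Lemma integrable_inv_pos_density :
  P.-integrable setT (EFin \o (fun x => (f x)^-1)).
Proof.
apply/integrableP; split.
  by apply/measurable_EFinP; exact: measurable_inv_pos_density.
under eq_integral => x _.
  rewrite gee0_abs/=; last by rewrite lee_fin invr_ge0 ltW// pos_density_gt0.
  over.
apply: le_lt_trans (integral_inv_pos_density _ _ PQ _ measurableT) _.
by rewrite probability_setT ltry.
Qed.

(** At [r = 1] the tangent bound dominates the negative part by [1 / f], which is integrable; an
    infinite positive part would then make the divergence infinite. *)
Lemma integrable_ln_pos_density : (KL_divergence P Q < +oo)%E ->
  P.-integrable setT (EFin \o (fun x => ln (f x))).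
Proof.
rewrite (KL_divergenceE _ _ PQ) => Dfin.
set k := EFin \o _.
have mk : measurable_fun setT k.
  by apply/measurable_EFinP; exact: measurable_ln_pos_density.
have kn : (\int[P]_x k^\- x < +oo)%E.
  have /integrableP[mw] := integrable_inv_pos_density.
  apply: le_lt_trans; apply: ge0_le_integral => //.
  - exact: measurable_funeneg.
  - exact: measurableT_comp.
  move=> x _; rewrite funenegE /k/= ge_max !lee_fin.
  have f0 := pos_density_gt0 P Q x.
  have w0 : 0 <= (f x)^-1 by rewrite invr_ge0 ltW.
  rewrite ger0_norm// w0 andbT.
  by have := ln_pos_density_ge 1 x ltr01; rewrite ln1; lra.
have kp : (\int[P]_x k^\+ x < +oo)%E.
  rewrite ltey; apply: contraTN Dfin => /eqP kp.
  rewrite -leNgt integralE -/k kp leye_eq; apply/eqP.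
  by rewrite addye// eqe_oppLR/= lt_eqF.
apply/integrableP; split => //.
under eq_integral do rewrite -/((abse \o k) _) fune_abse.
rewrite ge0_integralD//.
- by rewrite lte_add_pinfty.
- exact: measurable_funepos.
- exact: measurable_funeneg.
Qed.

Hypothesis Dfin : (KL_divergence P Q < +oo)%E.

Lemma fine_KL_divergenceE : fine (KL_divergence P Q) = \int[P]_x ln (f x).
Proof. by rewrite (KL_divergenceE _ _ PQ). Qed.

(** Integrate the tangent bound over [A] with [r = P A / Q A]: the extra terms [P A] and [r] times
    the integral of [1 / f] leave a nonnegative difference. *)
Lemma log_sum_le_Rintegral A : measurable A ->
  fine (P A) * ln (fine (P A) / fine (Q A)) <= \int[P]_(x in A) ln (f x).
Proof.
move=> mA.
have iw : P.-integrable A (EFin \o (fun x => (f x)^-1)).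
  exact: integrableS measurableT mA (@subsetT _ _) integrable_inv_pos_density.
have ik : P.-integrable A (EFin \o (fun x => ln (f x))).
  exact: integrableS measurableT mA (@subsetT _ _) (integrable_ln_pos_density Dfin).
have [PA0|PA0] := eqVneq (P A) 0%E.
  rewrite PA0 mul0r /Rintegral null_set_integral//.
  by case/integrableP: ik.
have QA0 : Q A != 0%E.
  apply/eqP => QA0; case/eqP: PA0.
  by move/null_content_dominatesP : PQ; apply.
have p0 : 0 < fine (P A).
  by rewrite fine_gt0// lt0e PA0 measure_ge0 ltey_eq fin_num_measure.
have q0 : 0 < fine (Q A).
  by rewrite fine_gt0// lt0e QA0 measure_ge0 ltey_eq fin_num_measure.
set p := fine (P A) in p0 *; set q := fine (Q A) in q0 *.
have r0 : 0 < p / q by rewrite divr_gt0.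
have irw : P.-integrable A (EFin \o (fun x => p / q * (f x)^-1)).
  exact: (integrableZl mA (p / q) iw).
have ic := finite_measure_integrable_cst P (1 + ln (p / q)) mA.
have := @le_Rintegral _ _ _ P A
  (fun x => (1 + ln (p / q)) - p / q * (f x)^-1) (fun x => ln (f x)) mA
  (integrableB mA ic irw) ik (fun x _ => ln_pos_density_ge _ x r0).
apply: le_trans.
rewrite RintegralB// Rintegral_cst// RintegralZl// -/p.
have : \int[P]_(x in A) (f x)^-1 <= q.
  apply: fine_le; rewrite ?fin_num_measure//; first exact: integrable_fin_num.
  exact: integral_inv_pos_density.
move=> h.
have : p / q * \int[P]_(x in A) (f x)^-1 <= p / q * q by rewrite ler_pM2l.
rewrite divfK ?gt_eqF//; lra.
Qed.

End divergence.

(** * From the divergence to the probability of an event *)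

Section event_bound.
Context {d : measure_display} {T : measurableType d} {R : realType}.
Variables P Q : probability T R.

Lemma KL_divergence_dominates : (KL_divergence P Q < +oo)%E -> P `<< Q.
Proof. by rewrite /KL_divergence; case: pselect. Qed.

Lemma KL_divergence_ge0 : (KL_divergence P Q < +oo)%E ->
  0 <= fine (KL_divergence P Q).
Proof.
move=> D; have PQ := KL_divergence_dominates D.
rewrite fine_KL_divergenceE//; have := log_sum_le_Rintegral _ _ PQ D _ measurableT.
by rewrite !probability_setT/= divr1 ln1 mulr0.
Qed.

(** Data processing for a two-cell partition: the log-sum inequality on [E] plus that on its
    complement. *)
Lemma binary_KL_le (E : set T) : (KL_divergence P Q < +oo)%E -> measurable E ->
  let p := fine (P E) in let q := fine (Q E) in
  p * ln (p / q) + (1 - p) * ln ((1 - p) / (1 - q)) <= fine (KL_divergence P Q).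
Proof.
move=> D mE; have PQ := KL_divergence_dominates D.
have mE' : measurable (~` E) by exact: measurableC.
have fineC (S : probability T R) : fine (S (~` E)) = 1 - fine (S E).
  by rewrite probability_setC// fineB// fin_num_measure.
have := log_sum_le_Rintegral _ _ PQ D _ mE.
have := log_sum_le_Rintegral _ _ PQ D _ mE'; rewrite !fineC.
rewrite fine_KL_divergenceE// -(setUv E) Rintegral_setU//; first by move=> ? ? /=; lra.
- by rewrite setUv; exact: integrable_ln_pos_density.
- by apply/disj_set2P; rewrite setICr.
Qed.

Lemma prob_le_fhat (E : set T) : measurable E ->
  0 < fine (Q E) <= 1 / 2 ->
  (KL_divergence P Q <= (ln (1 / fine (Q E)))%:E)%E ->
  fine (P E) <= fhat (fine (Q E)) (fine (KL_divergence P Q)).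
Proof.
move=> mE q01 Dle.
have D : (KL_divergence P Q < +oo)%E by rewrite (le_lt_trans Dle) ?ltry.
have y0 := KL_divergence_ge0 D.
have := binary_KL_le _ D mE.
have yq : fine (KL_divergence P Q) <= - ln (fine (Q E)).
  move: Dle y0; case: (KL_divergence P Q) => [r| |]//=.
  - by rewrite lee_fin div1r lnV// posrE; lra.
  - rewrite oppr_ge0 ln_le0//; lra.
have p01 : 0 <= fine (P E) <= 1.
  by rewrite fine_ge0//= -lee_fin fineK ?fin_num_measure// probability_le1.
move: (fine (KL_divergence P Q)) (fine (P E)) (fine (Q E)) q01 p01 y0 yq => /=.
move=> y p q q01 p01 y0 yq h.
apply: le_fhat => //; first by rewrite y0.
have := entropy_le_sqrt _ p01.
(* The logarithm of the quotient splits only for [p > 0]; at [p = 0] the outer factor annihilates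
   both sides. *)
have e1 : p * ln (p / q) = p * ln p - p * ln q.
  have [->|p0] := eqVneq p 0; first by rewrite !mul0r subr0.
  rewrite ln_div ?posrE ?mulrBr//; lra.
have e2 : (1 - p) * ln ((1 - p) / (1 - q)) = (1 - p) * ln (1 - p) - (1 - p) * ln (1 - q).
  have [->|p0] := eqVneq (1 - p) 0; first by rewrite !mul0r subr0.
  rewrite ln_div ?posrE ?mulrBr//; lra.
rewrite ln_oddsE//; lra.
Qed.
End event_bound.

Theorem corollary1 (R : realType) :
  [/\ (forall q : R, 0 < q <= 1 / 2 ->
        [/\ (forall y : R, 0 <= y <= - ln q -> 0 <= g_ q y /\ 0 <= fhat q y),
            concave_function ([set` `[0, - ln q]] : set R) (fhat q) &
            {in `[0, - ln q] &, {homo fhat q : x y / x <= y}}]),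
      (forall (d : measure_display) (Z : measurableType d)
          (P Q : probability Z R) (E : set Z),
        measurable E ->
        0 < fine (Q E) <= 1 / 2 ->
        (KL_divergence P Q <= (ln (1 / fine (Q E)))%:E)%E ->
        fine (P E) <= fhat (fine (Q E)) (fine (KL_divergence P Q))) &
      (forall (d1 d2 : measure_display) (X : measurableType d1)
          (Y : measurableType d2) (PXY : probability (X * Y)%type R)
          (E : set (X * Y)),
        measurable E ->
        0 < fine (marginal_product PXY E) <= 1 / 2 ->
        (mutual_information PXY <=
          (ln (1 / fine (marginal_product PXY E)))%:E)%E ->
        fine (PXY E) <=
          fhat (fine (marginal_product PXY E)) (fine (mutual_information PXY)))].
Proof.
split.
- move=> q q01; split; last exact: fhat_homo.
  + by move=> y y01; rewrite g_ge0 ?fhat_ge0.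
  + exact: concave_fhat.
- by move=> d Z P Q E; exact: prob_le_fhat.
- by move=> d1 d2 X Y PXY E; exact: prob_le_fhat.
Qed.
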